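(* Let $\beta\ge5$, $\epsilon_1\in\{0,1\}$ and $\epsilon_2\in\{1,-1\}$. (a) There is no tight chiral $4$-polytope of type $\{2^{\beta-1},2^\beta,8\}$ whose standard generators satisfy $\sigma_2\sigma_1^{-1}=\sigma_1\sigma_2^{3-\epsilon_12^{\beta-1}}$ and $\sigma_2\sigma_3^2=\sigma_3^2\sigma_2^{1+\epsilon_22^{\beta-2}}$. (b) There is no tight chiral $4$-polytope of type $\{2^{\beta-1},2^\beta,2^{\beta-1}\}$ whose standard generators satisfy $\sigma_2\sigma_1^{-1}=\sigma_1\sigma_2^{3-\epsilon_12^{\beta-1}}$, $\sigma_3^{-1}\sigma_2=\sigma_2^{3+\epsilon_22^{\beta-2}}\sigma_3^{1-2^{\beta-2}}$ and $\sigma_3\sigma_2^{-1}=\sigma_2^{-3+\epsilon_22^{\beta-2}}\sigma_3^{-1+2^{\beta-2}}$.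
   Context: For a chiral polytope with base flag $\Phi$, the standard generators $\sigma_1,\sigma_2,\sigma_3$ of its automorphism group are the automorphisms with $\Phi\sigma_i=\Phi^{i(i-1)}$, where $\Phi^j$ is the flag differing from $\Phi$ only in its $j$-face; for type $\{p,q,r\}$ they have orders $p,q,r$ and satisfy $(\sigma_1\sigma_2)^2=(\sigma_2\sigma_3)^2=(\sigma_1\sigma_2\sigma_3)^2=1$. Tight: type $\{p,q,r\}$ with exactly $2pqr$ flags. *)

(* Defs.v *)
From mathcomp Require Import all_boot all_fingroup all_algebra.
Set Implicit Arguments. Unset Strict Implicit. Unset Printing Implicit Defensive.

Definition gzpow (gT : finGroupType) (x : gT) (z : int) : gT :=
  match z with
  | Posz n => (x ^+ n)%g
  | Negz n => ((x ^+ n.+1)^-1)%g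
  end.

Section Polytope.
Variables (T : finType) (le : rel T) (rk : T -> nat).
(* rk x = (rank of x) + 1, so ranks -1..4 become 0..5 *)

Definition ltP (x y : T) := (x != y) && le x y.

Definition is_chain (C : {set T}) :=
  [forall x in C, forall y in C, le x y || le y x].

Definition maximal_chain (C : {set T}) :=
  is_chain C && [forall D : {set T}, (is_chain D && (C \subset D)) ==> (D == C)].

(* a flag, listed by rank: f i is its face of rank i-1 *)
Definition is_flag (f : {ffun 'I_6 -> T}) :=
  [forall i, rk (f i) == i] && [forall i : 'I_6, forall j : 'I_6, (i <= j)%N ==> le (f i) (f j)].

(* g differs from f exactly in the face at index j (i.e. of rank j-1) *)
Definition adj_at (j : 'I_6) (f g : {ffun 'I_6 -> T}) :=
  [&& is_flag f, is_flag g, f j != g j & [forall k, (k != j) ==> (f k == g k)]].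

Definition adj (f g : {ffun 'I_6 -> T}) := [exists j, adj_at j f g].

Definition keeps (f g h : {ffun 'I_6 -> T}) := [forall i, (f i == g i) ==> (h i == f i)].

Definition strongly_flag_connected : Prop :=
  forall f g, is_flag f -> is_flag g ->
    exists s : seq {ffun 'I_6 -> T},
      [/\ path adj f s, last f s = g & all (keeps f g) s].

Definition is_polytope4 : Prop :=
  [/\
      (forall x, le x x) /\ (forall x y, le x y -> le y x -> x = y) /\ (forall x y z, le x y -> le y z -> le x z),
      (forall x y, ltP x y -> rk x < rk y) /\ (forall x, rk x <= 5),
      ((exists bot, forall x, le bot x) /\ (exists top, forall x, le x top)) /\
      ((forall C, maximal_chain C -> forall i, i <= 5 -> exists2 x, x \in C & rk x = i)),
      (forall x y, ltP x y -> rk y = (rk x).+2 ->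
          #|[set z | ltP x z && ltP z y]| = 2)
    & strongly_flag_connected].

Definition is_aut (s : {perm T}) := forall x y, le (s x) (s y) = le x y.

(* image of a flag under an automorphism (right action: Phi s) *)
Definition act (s : {perm T}) (f : {ffun 'I_6 -> T}) : {ffun 'I_6 -> T} :=
  [ffun i => s (f i)].

Definition same_orbit (f g : {ffun 'I_6 -> T}) := exists2 s, is_aut s & g = act s f.

(* chiral: two flag orbits, adjacent flags in distinct orbits *)
Definition chiral : Prop :=
  (forall f g h, is_flag f -> is_flag g -> is_flag h ->
     [\/ same_orbit f g, same_orbit g h | same_orbit f h]) /\
  (forall j f g, adj_at j f g -> ~ same_orbit f g).

Definition has_type (p q r : nat) : Prop :=
  [/\ (forall y, rk y = 3 -> #|[set x | le x y & rk x == 1]| = p),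
      (forall x y, rk x = 1 -> rk y = 4 -> le x y ->
          #|[set z | [&& rk z == 2, le x z & le z y]]| = q)
    & (forall x, rk x = 2 -> #|[set z | le x z & rk z == 3]| = r)].

Definition tight (p q r : nat) : Prop :=
  #|[set f : {ffun 'I_6 -> T} | is_flag f]| = (2 * p * q * r)%N.

(* s is the standard generator sigma_i w.r.t. base flag Phi: Phi s = Phi^{i,i-1} *)
Definition std_gen (Phi : {ffun 'I_6 -> T}) (i : nat) (s : {perm T}) : Prop :=
  is_aut s /\ exists Psi, adj_at (inord i.+1) Phi Psi /\ adj_at (inord i) Psi (act s Phi).

Definition tight_chiral_std (p q r : nat) (Phi : {ffun 'I_6 -> T})
    (s1 s2 s3 : {perm T}) : Prop :=
  [/\ is_polytope4 /\ chiral, has_type p q r /\ tight p q r, is_flag Phi,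
      std_gen Phi 1 s1 & std_gen Phi 2 s2 /\ std_gen Phi 3 s3].

End Polytope.

(* Main.v *)
Require Import Defs.
From mathcomp Require Import all_boot all_fingroup all_algebra.
From mathcomp Require Import cyclic zify.
Set Implicit Arguments. Unset Strict Implicit. Unset Printing Implicit Defensive.
Local Open Scope group_scope.

(** The relations alone force [s2 ^+ 2 ^ (beta - 1) = 1], whereas in a chiral
    polytope the order of [s2] is the number [2 ^ beta] of edges of the section
    it rotates. Write [a, b, c] for [s1, s2, s3] and [w] for the power of [b] of
    order 4 that occurs in the relations. In both cases [a] centralises [b ^+ 4]
    and fixes [b ^+ 2] up to [w ^+ 2], and the involution [a * b] inverts [c];
    conjugating the relations between [b] and [c] by it gives [w ^+ 2 = 1]. *)

(** * Group theory: what the relations between three generators force *)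

Section GroupWords.
Variable gT : finGroupType.
Implicit Types (a b c w x y z : gT) (e : nat).

Lemma gzpow_sub x (m n : nat) : gzpow x (m%:Z - n%:Z)%R = x ^+ m * x ^- n.
Proof.
case: (leqP n m) => [le_nm | lt_mn].
  by rewrite subzn //= -{2}(subnK le_nm) expgD mulgK.
rewrite -[(_ - _)%R]GRing.opprB subzn 1?ltnW //.
rewrite -{2}(subnK (ltnW lt_mn)) expgD invMg mulKVg.
(* The opposite of [0] is a [Posz], not a [Negz], so a zero difference is split off. *)
by case: (n - m) => [|k]; rewrite ?invg1.
Qed.

Lemma gzpowD x (i j : int) : gzpow x (i + j)%R = gzpow x i * gzpow x j.
Proof.
have dec (k : int) : {mn : nat * nat | k = (mn.1%:Z - mn.2%:Z)%R}.
  case: k => k; first by exists (k, 0%N); rewrite GRing.subr0.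
  by exists (0%N, k.+1); rewrite GRing.sub0r.
have [[[m1 n1] /= ->] [[m2 n2] /= ->]] := (dec i, dec j).
rewrite GRing.addrACA -GRing.opprD -!PoszD !gzpow_sub [(n1 + n2)%N]addnC.
rewrite !expgD invMg -!mulgA; congr (_ * _).
have /commuteV comx : commute (x ^+ m2) (x ^+ n1) by exact/commuteX2.
by rewrite !mulgA comx.
Qed.

Lemma gzpowN x (i : int) : gzpow x (- i)%R = (gzpow x i)^-1.
Proof.
by apply/esym/eqP; rewrite eq_invg_mul -gzpowD GRing.subrr.
Qed.

(** This dihedral form of the relations makes [a * b] invert [c] and [b * c] invert [a]. *)
Lemma conj_invol x y : x ^+ 2 = 1 -> (x * y) ^+ 2 = 1 -> y ^ x = y^-1.
Proof.
rewrite !expg2 => /eqP; rewrite -eq_invg_mul => /eqP xV xyxy.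
apply/eqP; rewrite eq_sym eq_invg_mul conjgE xV; apply/eqP.
by apply: (mulgI x); rewrite mulg1 -[RHS]mul1g -xyxy !mulgA.
Qed.

Lemma sqr_mulgC x y : (x * y) ^+ 2 = 1 -> (y * x) ^+ 2 = 1.
Proof.
move=> xy2; have -> : y * x = (x * y) ^ x by rewrite conjgE !mulgA mulVg mul1g.
by rewrite -conjXg xy2 conj1g.
Qed.

Lemma inv_sandwich x y : (x * y) ^+ 2 = 1 -> x^-1 = y * x * y.
Proof. by rewrite expg2 => xyxy; apply/eqP; rewrite eq_invg_mul !mulgA -xyxy !mulgA. Qed.

(** Since [a^-1 = b * a * b], the second hypothesis reads [b ^+ 2 * a * b = a * b ^+ 3 * x], and one
    factor [b] cancels on the right. *)
Lemma conj_sqr a b x : (a * b) ^+ 2 = 1 -> b * a^-1 = a * (b ^+ 3 * x) ->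
  commute b x -> (b ^+ 2) ^ a = b ^+ 2 * x.
Proof.
move=> /inv_sandwich aV ba cbx.
rewrite conjgE; apply: (mulgI a); apply: (mulIg b); rewrite mulKVg.
rewrite -!mulgA -cbx.
have -> : b * (b * (b * x)) = b ^+ 3 * x by rewrite !expgS mulg1 -!mulgA.
by rewrite -ba aV !mulgA.
Qed.

(** Squaring the last hypothesis kills the factor in [w], because [w ^+ 4 = 1]. Hence [a] fixes
    [b ^+ 4] and all its powers, [w] among them. *)
Lemma conj_cycle_pow4 a b w e :
    w \in <[b ^+ 4]> -> w ^+ 4 = 1 -> (b ^+ 2) ^ a = b ^+ 2 * (w ^+ 2) ^+ e ->
  w ^ a = w.
Proof.
case/cycleP=> k Dw w4 b2a.
have b4a : (b ^+ 4) ^ a = b ^+ 4.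
  rewrite -[4]/(2 * 2)%N expgM conjXg b2a expgMn.
    by rewrite (expgnAC (w ^+ 2)) -(expgM w) w4 expg1n mulg1.
  by do 2!apply: commuteX; rewrite Dw -expgM; apply: commuteX2.
by rewrite Dw conjXg b4a.
Qed.

(* [b ^ c] and [b] generate a group of class 2 with central commutator [w], and
   [c ^- 2 = b ^ c * b]; its fourth power is [w ^- 2] times a factor which is
   trivial because [a * b] inverts [c]. *)
Lemma collapse_a a b c w e :
    (a * b) ^+ 2 = 1 -> (b * c) ^+ 2 = 1 -> (a * b * c) ^+ 2 = 1 -> c ^+ 8 = 1 ->
    w \in <[b ^+ 4]> -> w ^+ 4 = 1 ->
    (b ^+ 2) ^ a = b ^+ 2 * (w ^+ 2) ^+ e -> b ^ (c ^+ 2) = b * w ->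
  w ^+ 2 = 1.
Proof.
move=> ab2 bc2 abc2 c8 wb4 w4 b2a bc.
have wa := conj_cycle_pow4 wb4 w4 b2a.
have cwb : commute w b.
  by case/cycleP: wb4 => k ->; rewrite -expgM; apply/commute_sym/commuteX.
have [b' Db'] : {x | x = b ^ c} by exists (b ^ c).
have [w' Dw'] : {x | x = w ^ c} by exists (w ^ c).
have Dc : c ^- 2 = b' * b.
  by rewrite expg2 invMg {2}(inv_sandwich (sqr_mulgC bc2)) Db' conjgE !mulgA.
(* With [c ^- 2 = b' * b], [bc] becomes a commutator relation between [b] and [b']; [E2] is the same
   relation transported by [c]. *)
have E1 : b' * b = w * b * b'.
  by apply: (mulIg b); rewrite cwb -bc -[RHS]mulgA -Dc conjgCV invgK.
have cwb' : commute w' b' by rewrite /commute Db' Dw' -!conjMg cwb.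
have E2 : b * b' = w' * b' * b.
  have b'c : b' ^ (c ^+ 2) = b' * w'.
    by rewrite Db' Dw' -conjgM -expgS expgSr conjgM bc conjMg.
  apply: (mulgI b'); rewrite !mulgA.
  by rewrite -b'c -[RHS]mulgA -Dc conjgCV invgK.
(* Substituting [E2] into [E1] gives [b' * b = w * w' * b' * b]. *)
have w'V : w' = w^-1.
  apply/esym/eqP; rewrite eq_invg_mul; apply/eqP.
  by apply: (mulIg (b' * b)); rewrite mul1g [in RHS]E1 -!mulgA E2 !mulgA.
have {}cwb' : commute w b'.
  by apply/commute_sym; rewrite -(invgK w) -w'V; apply/commuteV/commute_sym.
have zc : (w ^+ 2) ^ c = w ^+ 2.
  by rewrite conjXg -Dw' w'V expVgn; apply/eqP; rewrite eq_invg_mul -expgD w4.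
(* Conjugating [b2a] by [b * c] sends [b] to [b'], inverts [a] and fixes [w ^+ 2]; the result is
   then solved for conjugation by [a]. *)
have b'2a : (b' ^+ 2) ^ a = b' ^+ 2 * (w ^+ 2) ^- e.
  have au : a ^ (b * c) = a^-1 by apply: conj_invol; rewrite // sqr_mulgC // mulgA.
  have zu : (w ^+ 2) ^ (b * c) = w ^+ 2.
    have wb : w ^ b = w by rewrite conjgE cwb mulKg.
    by rewrite conjgM [_ ^ b]conjXg wb.
  have bb : b ^ b = b by rewrite conjgE mulKg.
  have : ((b ^+ 2) ^ a) ^ (b * c) = (b ^+ 2 * (w ^+ 2) ^+ e) ^ (b * c) by rewrite b2a.
  rewrite conjJg au (conjMg _ ((w ^+ 2) ^+ e)) (conjXg (w ^+ 2)) zu.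
  rewrite (conjXg b) (conjgM b) bb -Db' => b'2aV.
  have za : ((w ^+ 2) ^+ e) ^ a = (w ^+ 2) ^+ e by rewrite !conjXg wa.
  by apply: (mulIg ((w ^+ 2) ^+ e)); rewrite mulgKV -{1}za -conjMg -b'2aV conjgKV.
(* As [a * b] inverts [c], it inverts [c ^- 2 = b' * b]; conjugation by [b] takes [b * b'] to
   [b' * b] and can be stripped off. *)
have tinv : (b' * b) ^ a = (b * b')^-1.
  have t_c : (b' * b) ^ (a * b) = (b' * b)^-1.
    by rewrite -Dc (conjVg (c ^+ 2)) (conjXg c) (conj_invol ab2 abc2) expVgn.
  by apply: (conjg_inj b); rewrite -conjgM t_c conjVg conjgE -(mulgA b) mulKg.
have cVb' : b' * w^-1 = w^-1 * b' by apply/commuteV/commute_sym.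
have S1 : (b' * b) ^+ 2 = w^-1 * (b' ^+ 2 * b ^+ 2).
  by rewrite !expg2 !mulgA -(mulgA b' b b') E2 w'V !mulgA cVb'.
have S2 : (b * b') ^+ 2 = w * (b ^+ 2 * b' ^+ 2).
  by rewrite !expg2 !mulgA -(mulgA b b' b) E1 !mulgA -cwb.
have bJ : b ^ b'^-1 = w * b by rewrite conjgE invgK mulgA E1 mulgK.
have wJ : w ^ b'^-1 = w by rewrite conjgE invgK mulgA -cwb' mulgK.
(* Conjugating twice by [b'^-1] turns [b] into [w ^+ 2 * b], whose square is again [b ^+ 2]. *)
have cb2 : commute (b ^+ 2) (b' ^+ 2).
  have : (b ^+ 2) ^ (b' ^- 2) = b ^+ 2.
    rewrite -expVgn (expg2 b'^-1) (conjgM (b ^+ 2)) (conjXg b) bJ.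
    rewrite (conjXg (w * b)) conjMg wJ bJ.
    by rewrite mulgA -expg2 expgMn -1?expgM ?w4 ?mul1g //; apply/commute_sym/commuteX.
  by move=> b2J; rewrite /commute -{1}b2J conjgE invgK (mulgA (b' ^+ 2)) mulgKV.
have cwX : commute w (b' ^+ 2 * b ^+ 2) by apply: commuteM; apply: commuteX.
(* Write [X] for [b' ^+ 2 * b ^+ 2]. Squaring [tinv] and expanding by [S1] and [S2] equates
   [w^-1 * X ^ a] with [w^-1 * X^-1], and [X ^ a = X] because the powers of [w ^+ 2] from [b'2a] and
   [b2a] cancel. *)
have X2 : b' ^+ 2 * b ^+ 2 = (b' ^+ 2 * b ^+ 2)^-1.
  apply: (mulgI w^-1); rewrite -[in RHS]invMg -cwX -{2}cb2 -S2.
  rewrite -expVgn -tinv -conjXg S1 conjMg conjVg wa (conjMg (b' ^+ 2)) b'2a b2a.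
  have cz : commute (b ^+ 2) ((w ^+ 2) ^+ e).
    by apply: commuteX; apply: commuteX2.
  by rewrite cz -(mulgA (b' ^+ 2)) mulKg.
(* By [S1], [c ^- 8] is [w ^- 2] times the square of an element equal to its inverse. *)
have : (c ^- 2) ^+ 2 ^+ 2 = 1 by rewrite -expgM expVgn -expgM c8 invg1.
rewrite Dc S1 expgMn; last exact/commute_sym/commuteV/commute_sym.
rewrite [_ ^+ 2 in X in _ * X]expg2 {1}X2 mulVg mulg1 expVgn => /eqP.
by rewrite invg_eq1 => /eqP.
Qed.

(* With [k := y * w^-1] the last two hypotheses say that [c] and [b ^+ 2] have
   commutators [k] and [k^-1]. Hence [b ^+ 3] inverts [k], so that [b ^+ 2]
   centralises [k], and conjugation by [a * b] shows that [k] is an involution. *)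
Lemma collapse_b a b c w y e :
    (a * b) ^+ 2 = 1 -> (b * c) ^+ 2 = 1 -> (a * b * c) ^+ 2 = 1 ->
    coprime #[b] 3 -> w \in <[b ^+ 4]> -> w ^+ 4 = 1 -> y \in <[c]> -> y ^+ 2 = 1 ->
    (b ^+ 2) ^ a = b ^+ 2 * (w ^+ 2) ^+ e ->
    c^-1 * b = b ^+ 3 * w * (c * y^-1) -> c * b^-1 = b ^- 3 * w * (c^-1 * y) ->
  w ^+ 2 = 1.
Proof.
move=> ab2 bc2 abc2 ob3 wb4 w4 yc y2 b2a R2 R3.
have wa := conj_cycle_pow4 wb4 w4 b2a.
have cwb : commute w b.
  by case/cycleP: wb4 => m ->; rewrite -expgM; apply/commute_sym/commuteX.
have cyc : commute c y by case/cycleP: yc => m ->; apply: commuteX.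
have yV : y^-1 = y by apply/eqP; rewrite eq_invg_mul -expg2 y2.
have cV := inv_sandwich (sqr_mulgC bc2).
have [d Dd] : {x | x = b * b} by exists (b * b).
have [k Dk] : {x | x = y * w^-1} by exists (y * w^-1).
have kV : k^-1 = w * y by rewrite Dk invMg invgK yV.
(* Replacing [c^-1] by [b * c * b] in [R2] leaves only [c] and [d = b ^+ 2]; [Q1] comes from [R3] in
   the same way after inversion. *)
have Q2 : c * d = d * k^-1 * c.
  apply: (mulgI b); rewrite kV Dd; move: R2.
  by rewrite {1}cV yV !expgS mulg1 cyc !mulgA.
have Q1 : d * c = c * k * d.
  have c3 : c = b^-1 * c^-1 * b^-1 by rewrite -{1}(invgK c) {1}cV !invMg !mulgA.
  apply: invg_inj; rewrite !invMg kV Dd !invMg; apply: (mulgI b^-1).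
  move: R3; rewrite !expgS mulg1 !invMg {1}c3 !mulgA => ->.
  by rewrite -!mulgA -(commuteV (commute_sym cyc)).
have cbd : commute b d by rewrite Dd; apply: commuteM.
have kB : k * (d * b) = d * b * k^-1.
  have bcV : b * c = c^-1 * b^-1.
    by rewrite -invMg; apply/esym/eqP; rewrite eq_invg_mul -expg2 bc2.
  have : c^-1 * b^-1 * k * d = d * (c^-1 * b^-1).
    by rewrite -bcV mulgA -cbd -[in RHS]mulgA Q1 !mulgA.
  move=> E; have -> : k * (d * b) = b * (c * (d * c^-1)).
    apply: (mulgI (c^-1 * b^-1)); rewrite !mulgA in E *; rewrite E.
    by rewrite !mulgKV mulVg mul1g.
  by rewrite [c * _]mulgA Q2 mulgK mulgA cbd.
have cdk : commute k d.
  have kB2 : commute k (d ^+ 3).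
    have -> : d ^+ 3 = (d * b) * (d * b).
      by rewrite !expgS mulg1 -mulgA [b * _]mulgA cbd -!mulgA -Dd.
    move: (d * b) kB => B kB; have kVB : k^-1 * B = B * k.
      by apply: (mulgI k); rewrite mulKVg mulgA kB mulgKV.
    by rewrite /commute mulgA kB -!mulgA kVB.
  (* The order of [d] divides that of [b], so it is prime to 3 and [d] is a power of [d ^+ 3], the
     square of the element inverting [k]. *)
  have /eqP gd : generator <[d]> (d ^+ 3).
    rewrite generator_coprime (coprime_dvdl _ ob3) // Dd -expg2; exact: orderXdvd.
  have /cycleP[m ->] : d \in <[d ^+ 3]> by rewrite -gd cycle_id.
  exact: commuteX.
have cck : commute k c.
  apply: (mulIg d); rewrite -[RHS]Q1 -mulgA Q2 (commuteV (commute_sym cdk)).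
  by rewrite -!mulgA mulKVg.
have Dw : w = k^-1 * y by rewrite kV -mulgA -expg2 y2 mulg1.
have cwc : commute c w.
  by rewrite Dw; apply: commuteM => //; apply/commuteV/commute_sym.
have cyw : commute y w.
  by case/cycleP: yc => m ->; apply/commute_sym/commuteX/commute_sym.
(* Conjugation by [a * b] inverts [c], fixes [w] and [y], hence [k], and multiplies [d] by [z],
   which commutes with [c]. The image of [Q1] is thus [d * c^-1 = c^-1 * k * d], to be compared with
   [Q2]. *)
have kk : k = k^-1.
  have [z Dz] : {x | x = (w ^+ 2) ^+ e} by exists ((w ^+ 2) ^+ e).
  have wb : w ^ b = w by rewrite conjgE cwb mulKg.
  have wt : w ^ (a * b) = w by rewrite conjgM wa.
  have ct : c ^ (a * b) = c^-1 := conj_invol ab2 abc2.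
  have yt : y ^ (a * b) = y.
    by rewrite -[RHS]yV; case/cycleP: yc => m ->; rewrite conjXg ct expVgn.
  have dt : d ^ (a * b) = d * z.
    by rewrite Dd -expg2 conjgM b2a conjMg !conjXg wb Dz conjgE mulKg.
  have zz x : commute x w -> commute x z by move=> xw; rewrite Dz; do 2!apply: commuteX.
  have /(congr1 (conjg^~ (a * b))) := Q1.
  rewrite /= !conjMg dt ct {1}Dk conjMg conjVg yt wt -Dk.
  have zc : z * c^-1 = c^-1 * z by apply/commute_sym/zz/commute_sym/commuteV/commute_sym.
  rewrite -mulgA zc !mulgA => /mulIg E.
  apply: (mulIg d); rewrite -(commuteV (commute_sym cdk)).
  by apply: (mulIg c); rewrite -Q2; apply: (mulgI c^-1); rewrite mulKg !mulgA -E mulgKV.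
have : k * k = 1 by rewrite {1}kk mulVg.
rewrite -expg2 Dk expgMn; last exact: commuteV.
by rewrite y2 mul1g expVgn => /eqP; rewrite invg_eq1 => /eqP.
Qed.

(** The exponent is, up to sign, a quarter of the order of [b], so [w] has order 4. It is a multiple
    of 4 since [4 <= beta], and the sign is lost on squaring. *)
Lemma gzpow_quarter b beta (eps : int) (w := gzpow b (eps * (2 ^ (beta - 2))%N%:Z)%R) :
    4 <= beta -> (eps = 1 \/ eps = -1)%R -> #[b] = (2 ^ beta)%N ->
  [/\ w \in <[b ^+ 4]>, w ^+ 4 = 1, w ^+ 2 = b ^+ (2 ^ (beta - 1)) & w ^+ 2 <> 1].
Proof.
move=> beta4 epsP ob.
have N4 : (2 ^ (beta - 2) = 4 * 2 ^ (beta - 4))%N.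
  by rewrite -[4]/(2 ^ 2)%N -expnD; congr (_ ^ _)%N; lia.
have N2 : (2 ^ (beta - 2) * 2 = 2 ^ (beta - 1))%N by rewrite -expnSr; congr (_ ^ _)%N; lia.
have Nb : (2 ^ (beta - 1) * 2 = 2 ^ beta)%N by rewrite -expnSr; congr (_ ^ _)%N; lia.
have b2N : b ^+ (2 ^ (beta - 1)) ^+ 2 = 1 by rewrite -expgM Nb -ob expg_order.
have w_b : w \in <[b ^+ 4]> /\ w ^+ 2 = b ^+ (2 ^ (beta - 1)).
  rewrite /w; case: epsP => ->; rewrite ?GRing.mul1r ?GRing.mulN1r ?gzpowN /=.
    by rewrite -expgM N2 N4 expgM mem_cycle.
  rewrite groupV N4 expgM mem_cycle; split=> //.
  by rewrite -expgM -N4 expVgn -expgM N2; apply/eqP; rewrite eq_invg_mul -expg2 b2N.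
case: w_b => wb4 w2; split=> //; first by rewrite -[4]/(2 * 2)%N expgM w2.
rewrite w2 => /eqP; rewrite -order_dvdn ob => /dvdn_leq.
by rewrite expn_gt0 leq_exp2l // => /(_ isT); lia.
Qed.

(** Brings the relation between [s1] and [s2] to the form used by both collapse lemmas:
    [b ^+ (2 ^ (beta - 1))] is the involution [w ^+ 2], so its sign in the exponent is
    immaterial. *)
Lemma conj_sqr_gzpow a b beta (eps : int) e (w := gzpow b (eps * (2 ^ (beta - 2))%N%:Z)%R) :
    4 <= beta -> (eps = 1 \/ eps = -1)%R -> #[b] = (2 ^ beta)%N -> (a * b) ^+ 2 = 1 ->
    b * a^-1 = a * gzpow b (3 - (e * 2 ^ (beta - 1))%N%:Z)%R ->
  (b ^+ 2) ^ a = b ^+ 2 * (w ^+ 2) ^+ e.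
Proof.
move=> beta4 epsP ob ab2; have [_ w4 w2 _] := gzpow_quarter beta4 epsP ob.
rewrite (gzpow_sub b 3) => R1.
have -> : (w ^+ 2) ^+ e = b ^- (e * 2 ^ (beta - 1)).
  apply/esym/eqP; rewrite eq_invg_mul mulnC expgM -w2 -expgMn // -expgD.
  by rewrite -[(2 + 2)%N]/4 w4 expg1n.
by apply: conj_sqr => //; apply/commuteV/commuteX.
Qed.
End GroupWords.

(** * Faces, chains and flags of a 4-polytope *)

Section Flags.
Variables (T : finType) (le : rel T) (rk : T -> nat).
Hypothesis polyP : is_polytope4 le rk.

Local Notation flag := {ffun 'I_6 -> T}.
Local Notation isf := (is_flag le rk).
Local Notation adjn := (adj_at le rk).
Implicit Types (f g h : flag) (s : {perm T}) (i j k : 'I_6).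

Lemma face_refl x : le x x.
Proof. by case: polyP => -[]. Qed.

Lemma face_trans x y z : le x y -> le y z -> le x z.
Proof. by case: polyP => -[_ [_ tr]] *; apply: tr; eassumption. Qed.

Lemma rk_lt x y : le x y -> x != y -> rk x < rk y.
Proof.
case: polyP => _ [lt_rk _] _ _ _ lexy neqxy.
by apply: lt_rk; rewrite /Defs.ltP neqxy.
Qed.

Lemma rk_le5 x : rk x <= 5.
Proof. by case: polyP => _ []. Qed.

Lemma rk_mono x y : le x y -> rk x <= rk y.
Proof. by move=> lexy; have [->|/(rk_lt lexy)/ltnW] := eqVneq x y. Qed.

Lemma comparable_rk_inj x y : le x y || le y x -> rk x = rk y -> x = y.
Proof.
have rk_le_inj u v : le u v -> rk u = rk v -> u = v.
  by move=> leuv eqrk; apply/eqP; apply/negPn/negP => /(rk_lt leuv); rewrite eqrk ltnn.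
by case/orP=> [/rk_le_inj // | /rk_le_inj e /esym/e].
Qed.

Lemma bottom_unique x y : rk x = 0 -> rk y = 0 -> x = y.
Proof.
case: polyP => _ _ [[[bot bot_le] _] _] _ _.
have eq_bot z : rk z = 0 -> bot = z.
  move=> z0; apply: comparable_rk_inj; rewrite ?bot_le //.
  by apply/eqP; rewrite z0 -leqn0 -z0 rk_mono.
by move=> /eq_bot <- /eq_bot <-.
Qed.

Lemma top_unique x y : rk x = 5 -> rk y = 5 -> x = y.
Proof.
case: polyP => _ _ [[_ [top le_top]] _] _ _.
have eq_top z : rk z = 5 -> z = top.
  move=> z5; apply: comparable_rk_inj; rewrite ?le_top //.
  by apply/eqP; rewrite eqn_leq rk_mono // z5 rk_le5.
by move=> /eq_top -> /eq_top ->.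
Qed.

Lemma flag_rk f i : isf f -> rk (f i) = i.
Proof. by case/andP=> /forallP/(_ i)/eqP. Qed.

Lemma flag_le f i j : isf f -> i <= j -> le (f i) (f j).
Proof. by case/andP=> _ /forallP/(_ i)/forallP/(_ j)/implyP. Qed.

Lemma flag_bottom f x : isf f -> le (f (inord 0)) x.
Proof.
move=> ff; case: (polyP) => _ _ [[[bot bot_le] _] _] _ _.
suff -> : f (inord 0) = bot by [].
apply: bottom_unique; rewrite ?flag_rk ?inordK //.
by have := rk_mono (bot_le (f (inord 0))); rewrite flag_rk // inordK // leqn0 => /eqP.
Qed.

Lemma flag_top f x : isf f -> le x (f (inord 5)).
Proof.
move=> ff; case: (polyP) => _ _ [[_ [top le_top]] _] _ _.
suff -> : f (inord 5) = top by [].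
apply: top_unique; rewrite ?flag_rk ?inordK //.
apply/eqP; rewrite eqn_leq rk_le5 /=.
by have := rk_mono (le_top (f (inord 5))); rewrite flag_rk // inordK.
Qed.

Lemma flag_lt f i j : isf f -> i < j -> Defs.ltP le (f i) (f j).
Proof.
move=> ff ltij; rewrite /Defs.ltP (flag_le ff) 1?ltnW // andbT.
by apply: contraTneq ltij => /(congr1 rk); rewrite !(flag_rk _ ff) => ->; rewrite ltnn.
Qed.

Lemma adjP j f g : adjn j f g ->
  [/\ isf f, isf g, f j != g j & forall k, k != j -> f k = g k].
Proof. by case/and4P=> ff fg neq /forallP eq; split=> // k nkj; apply/eqP/(implyP (eq k)). Qed.

Lemma adj_intro j f g : isf f -> isf g -> f j != g j ->
  (forall k, k != j -> f k = g k) -> adjn j f g.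
Proof. by move=> ff fg neq eq; apply/and4P; split=> //; apply/forallP=> k; apply/implyP=> /eq ->. Qed.

Lemma adj_sym j f g : adjn j f g -> adjn j g f.
Proof. by case/adjP=> ff fg neq eq; apply: adj_intro => //; rewrite 1?eq_sym // => k /eq. Qed.

(** The diamond condition between indices [j - 1] and [j + 1] leaves just one other face. At indices
    0 and 5 no adjacent flag exists, as bottom and top are unique. *)
Lemma adj_unique j f g h : adjn j f g -> adjn j f h -> g = h.
Proof.
case/adjP=> ff fg nfg efg /adjP[_ fh nfh efh].
have [j0 | j_gt0] := posnP j.
  by case/eqP: nfg; apply: bottom_unique; rewrite flag_rk.
have [j5 | nj5] := eqVneq (j : nat) 5.
  by case/eqP: nfg; apply: top_unique; rewrite flag_rk.
have j_lt5 : j < 5 by rewrite ltn_neqAle nj5 -ltnS ltn_ord.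
have ltpred : j.-1 < 6 by apply: leq_ltn_trans (leq_pred j) _.
have ltsucc : j.+1 < 6 by [].
pose l := Ordinal ltpred; pose u := Ordinal ltsucc.
have ltlj : l < j by rewrite /= prednK.
have ltju : j < u by [].
have diamond : #|[set z | Defs.ltP le (f l) z && Defs.ltP le z (f u)]| = 2.
  case: polyP => _ _ _ dia _; apply: dia; first exact/flag_lt/(ltn_trans ltlj).
  by rewrite !flag_rk //= prednK.
have inD e : isf e -> (forall k, k != j -> f k = e k) ->
    e j \in [set z | Defs.ltP le (f l) z && Defs.ltP le z (f u)].
  move=> fe ee; rewrite inE (ee l) ?(ee u) ?flag_lt //.
    by apply: contraTneq ltju => ->; rewrite ltnn.
  by apply: contraTneq ltlj => ->; rewrite ltnn.
have gh : g j = h j.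
  apply/eqP/negPn/negP => ngh; suff: 3 <= 2 by [].
  rewrite -[X in _ <= X]diamond cardE.
  apply: (@uniq_leq_size _ [:: f j; g j; h j]).
    by rewrite /= !inE negb_or nfg nfh ngh.
  by move=> z; rewrite mem_enum !in_cons in_nil orbF => /or3P[] /eqP->; apply: inD.
by apply/ffunP=> k; have [-> | nkj] := eqVneq k j; rewrite // -efg // efh.
Qed.

(** A maximal chain containing [C] meets every rank, and only once, since comparable faces of equal
    rank coincide. *)
Lemma flag_of_chain (C : {set T}) : is_chain le C ->
  exists2 f, isf f & forall x, x \in C -> f (inord (rk x)) = x.
Proof.
move=> chC; have [D maxD CD] := maxset_exists chC.
have /maxsetP[chD maxD'] := maxD.
have mD : maximal_chain le D.
  rewrite /maximal_chain chD; apply/forallP=> E; apply/implyP=> /andP[chE DE].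
  by apply/eqP/maxD'.
have cmpD x y : x \in D -> y \in D -> le x y || le y x.
  by move=> xD yD; move/forallP/(_ x)/implyP/(_ xD)/forallP/(_ y)/implyP: chD; apply.
have exD i : exists x, (x \in D) && (rk x == i).
  case: polyP => _ _ [_ ranked] _ _.
  by have [|x xD /eqP xi] := ranked D mD i; [rewrite -ltnS | exists x; rewrite xD].
pose f : flag := [ffun i => xchoose (exD i)].
have fP i : (f i \in D) /\ rk (f i) = i.
  by rewrite ffunE; have /andP[-> /eqP->] := xchooseP (exD i).
exists f => [|x /(subsetP CD) xD].
  apply/andP; split; apply/forallP=> i; first by rewrite (fP i).2.
  apply/forallP=> j; apply/implyP=> leij.
  have /orP[// | leji] := cmpD _ _ (fP i).1 (fP j).1.
  suff -> : f i = f j by apply: face_refl.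
  apply: comparable_rk_inj; first by rewrite leji orbT.
  by apply/eqP; rewrite eqn_leq (rk_mono leji) !(fP _).2 leij.
apply: comparable_rk_inj; first by apply: cmpD; rewrite ?(fP _).1.
by rewrite (fP _).2 inordK // ltnS rk_le5.
Qed.

Lemma face_in_flag x : exists2 f, isf f & exists i, f i = x.
Proof.
have [|f ff /(_ x (set11 x)) fx] := @flag_of_chain [set x].
  apply/forallP=> y; apply/implyP=> /set1P->.
  by apply/forallP=> z; apply/implyP=> /set1P->; rewrite face_refl.
by exists f => //; exists (inord (rk x)).
Qed.

(** * The action of automorphisms on flags *)

Lemma flag_actM s1 s2 f : Defs.act (s1 * s2) f = Defs.act s2 (Defs.act s1 f).
Proof. by apply/ffunP=> i; rewrite !ffunE permM. Qed.

Lemma flag_act1 f : Defs.act 1 f = f.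
Proof. by apply/ffunP=> i; rewrite !ffunE perm1. Qed.

Lemma aut_group_set :
  group_set [set s : {perm T} | [forall x, forall y, le (s x) (s y) == le x y]].
Proof.
apply/group_setP; split=> [|s1 s2].
  by rewrite inE; apply/forallP=> x; apply/forallP=> y; rewrite !perm1.
rewrite !inE => /forallP a1 /forallP a2; apply/forallP=> x; apply/forallP=> y.
by rewrite !permM (eqP (forallP (a2 _) _)) (forallP (a1 _) _).
Qed.

Definition aut_group := Group aut_group_set.

Lemma autP s : reflect (is_aut le s) (s \in aut_group).
Proof.
rewrite inE; apply: (iffP forallP) => [a x y | a x]; first exact/eqP/(forallP (a x)).
by apply/forallP=> y; apply/eqP.
Qed.

(* Ranks along the image of a flag strictly increase within [0, 5], hence are
   preserved. *)
Lemma act_flag s f : s \in aut_group -> isf f -> isf (Defs.act s f).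
Proof.
move=> /autP auts ff; set g := Defs.act s f.
have le_g i j : i <= j -> le (g i) (g j) by move=> leij; rewrite !ffunE auts flag_le.
have lt_g (i j : 'I_6) : i < j -> rk (g i) < rk (g j).
  move=> ltij; apply: rk_lt; first exact/le_g/ltnW.
  by rewrite !ffunE (inj_eq perm_inj); case/andP: (flag_lt ff ltij).
have ge_g n (ltn6 : n < 6) : n <= rk (g (Ordinal ltn6)).
  elim: n ltn6 => // n IHn ltn6.
  by apply: leq_ltn_trans (IHn (ltnW ltn6)) _; apply: lt_g.
(* Downward induction: [n] is the distance of the index [m] from the top index 5. *)
have le_g5 n m (ltm6 : m < 6) : n + m = 5 -> rk (g (Ordinal ltm6)) + n <= 5.
  elim: n m ltm6 => [|n IHn] m ltm6 Dm; first by rewrite addn0 rk_le5.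
  have ltm6' : m.+1 < 6 by rewrite -[6]/(5.+1) -Dm addSn !ltnS leq_addl.
  apply: leq_trans (IHn _ ltm6' _); last by rewrite -Dm addnS.
  by rewrite addnS -addSn leq_add2r; apply: lt_g.
apply/andP; split; apply/forallP=> i; last by apply/forallP=> j; apply/implyP; apply: le_g.
case: i => n ltn6; rewrite eqn_leq ge_g andbT.
have le_n5 : n <= 5 by [].
move: (rk (g (Ordinal ltn6))) (le_g5 (5 - n) n ltn6 (subnK le_n5)) => r /=.
by rewrite -{2}(subnKC le_n5) leq_add2r.
Qed.

Lemma act_adj s j f g : s \in aut_group -> adjn j f g -> adjn j (Defs.act s f) (Defs.act s g).
Proof.
move=> auts /adjP[ff fg neq eq]; apply: adj_intro; rewrite ?act_flag //.
  by rewrite !ffunE (inj_eq perm_inj).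
by move=> k /eq; rewrite !ffunE => ->.
Qed.

(** Uniqueness of adjacent flags propagates the fixed flag along paths, connectedness reaches every
    flag, and every face lies in a flag. *)
Lemma act_free s f : s \in aut_group -> isf f -> Defs.act s f = f -> s = 1.
Proof.
move=> auts ff sf; have fix_flag g : isf g -> Defs.act s g = g.
  case: polyP => _ _ _ _ conn fg; have [p [pth <- _]] := conn f g ff fg.
  elim: p f sf pth {ff conn fg} => //= h p IHp f sf /andP[/existsP[j fh]]; apply: IHp.
  by apply: (adj_unique (j := j) (f := f)) => //; rewrite -{1}sf act_adj.
apply/permP=> x; have [g fg [i <-]] := face_in_flag x.
by rewrite perm1 -{2}(fix_flag g fg) ffunE.
Qed.

Lemma flag_of_consecutive f : (forall i, rk (f i) = i) ->
  (forall i j, i.+1 = j -> le (f i) (f j)) -> isf f.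
Proof.
move=> rkf lef; apply/andP; split; apply/forallP=> i; first by rewrite rkf.
apply/forallP=> j; apply/implyP=> leij.
have [d Dj] : exists d, i + d = j by exists (j - i); rewrite subnKC.
elim: d j Dj {leij} => [|d IHd] j Dj.
  by rewrite (_ : i = j) ?face_refl //; apply: val_inj; rewrite /= -Dj addn0.
have ltd : i + d < 6 by have := ltn_ord j; rewrite -Dj addnS => /ltnW.
by apply: face_trans (IHd (Ordinal ltd) _) (lef (Ordinal ltd) _ _) => //=; rewrite -Dj addnS.
Qed.

(** Changes at the non-consecutive indices [j] and [k] commute. Hence [s] sends [g] to the flag [h]
    that is [k]-adjacent to [f], and both [f] and its image under [s ^+ 2] are [k]-adjacent to
    [h]. *)
Lemma adj_comm_involution s (j k : 'I_6) f g : s \in aut_group ->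
    (j.+1 < k) || (k.+1 < j) ->
  adjn j f g -> adjn k g (Defs.act s f) -> s ^+ 2 = 1.
Proof.
move=> auts jk fg gs; have [ff fflg nfg efg] := adjP fg; have [_ fs ngs egs] := adjP gs.
pose h : flag := [ffun i => if i == k then Defs.act s f k else f i].
have njk : j != k by apply: contraTneq jk => ->; rewrite !ltnNge leqnSn.
have hk : h k = Defs.act s f k by rewrite ffunE eqxx.
have hn i : i != k -> h i = f i by rewrite ffunE => /negbTE ->.
have sf i : i != j -> i != k -> Defs.act s f i = f i by move=> nij nik; rewrite -egs // efg.
have fh : isf h.
  apply: flag_of_consecutive => [i | i i' Di].
    by have [-> | nik] := eqVneq i k; rewrite ?hk ?hn // flag_rk.
  (* A neighbour of index [k] is never [j], so there [f] and its image under [s] share their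
     face. *)
  have [Ei | nik] := eqVneq i k; have [Ei' | ni'k] := eqVneq i' k.
  - by move: Di; rewrite Ei Ei' => /eqP; rewrite eqn_leq ltnn.
  - have ni'j : i' != j by rewrite -val_eqE /=; move: jk Di; rewrite Ei; lia.
    by rewrite Ei hk hn // -sf // flag_le // -Ei -Di.
  - have nij : i != j by rewrite -val_eqE /=; move: jk Di; rewrite Ei'; lia.
    by rewrite Ei' hk hn // -sf // flag_le // -Ei' -Di.
  - by rewrite !hn // flag_le // -Di.
have hf : adjn k h f.
  by apply: adj_intro => //; rewrite hk efg 1?eq_sym // eq_sym.
have hs : adjn j (Defs.act s f) h.
  apply: adj_intro => // [|i nij]; first by rewrite hn // -egs // eq_sym.
  by have [-> | nik] := eqVneq i k; rewrite ?hk // hn ?sf.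
have Eh : h = Defs.act s g := adj_unique hs (act_adj auts fg).
have ssf : Defs.act s (Defs.act s f) = f.
  by apply: adj_unique hf; rewrite Eh; apply: act_adj.
by apply: (act_free (f := f)); rewrite ?groupX // expg2 flag_actM.
Qed.

Lemma std_gen_aut (i : nat) s f : std_gen le rk f i s -> s \in aut_group.
Proof. by case=> /autP. Qed.

(** Each product changes [f] at two non-consecutive indices: 3 and 1, 4 and 2, 4 and 1
    respectively. *)
Lemma std_gens_relations f s1 s2 s3 :
    std_gen le rk f 1 s1 -> std_gen le rk f 2 s2 -> std_gen le rk f 3 s3 ->
  [/\ (s1 * s2) ^+ 2 = 1, (s2 * s3) ^+ 2 = 1 & (s1 * s2 * s3) ^+ 2 = 1].
Proof.
move=> g1 g2 g3; have [[A1 A2] A3] := (std_gen_aut g1, std_gen_aut g2, std_gen_aut g3).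
case: g1 => _ [f1 [ff1 fs1]]; case: g2 => _ [f2 [ff2 fs2]]; case: g3 => _ [f3 [ff3 fs3]].
have E2 : Defs.act s2 f1 = f2.
  exact: adj_unique (act_adj A2 ff1) (adj_sym fs2).
have E3 : Defs.act s3 f2 = f3.
  exact: adj_unique (act_adj A3 ff2) (adj_sym fs3).
have s12 : adjn (inord 1) f2 (Defs.act (s1 * s2) f).
  by rewrite flag_actM -E2; apply: act_adj.
have s23 : adjn (inord 2) f3 (Defs.act (s2 * s3) f).
  by rewrite flag_actM -E3; apply: act_adj.
have s123 : adjn (inord 1) f3 (Defs.act (s1 * s2 * s3) f).
  by rewrite flag_actM -E3; apply: act_adj.
split.
- by apply: adj_comm_involution ff2 s12; rewrite ?groupM // !inordK.
- by apply: adj_comm_involution ff3 s23; rewrite ?groupM // !inordK.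
- by apply: adj_comm_involution ff3 s123; rewrite ?groupM // !inordK.
Qed.

(** * The order of a standard generator as a number of faces *)

Section Order.
Hypothesis chiralP : chiral le rk.
Variables (Phi : flag) (n : nat) (s : {perm T}).
Hypotheses (PhiP : isf Phi) (n_gt0 : 0 < n) (n_lt4 : n < 4) (genP : std_gen le rk Phi n s).

Let auts : s \in aut_group := std_gen_aut genP.
Let sub_aut t : t \in <[s]> -> t \in aut_group.
Proof. by apply: subsetP; rewrite cycle_subG. Qed.

Let n_neqS : (inord n : 'I_6) != inord n.+1.
Proof. by rewrite -val_eqE /= !inordK; lia. Qed.

(* Every flag of the section lies in the orbit of [Phi] under [<[s]>] or is
   adjacent to that orbit at index [n.+1], which leaves the face at index [n]
   unchanged. *)
Lemma section_flag h : isf h ->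
    (forall k : 'I_6, k != inord n -> k != inord n.+1 -> h k = Phi k) ->
  exists2 t, t \in <[s]> & h (inord n) = t (Phi (inord n)).
Proof.
move=> fh hPhi; case: genP => _ [Psi [adj1 adj2]].
suff [t ts [-> | ->]] : exists2 t, t \in <[s]> & h = Defs.act t Phi \/ h = Defs.act t Psi.
- by exists t; rewrite ?ffunE.
- exists t => //; have [_ _ _ eqPsi] := adjP (act_adj (sub_aut ts) adj1).
  by rewrite -eqPsi ?ffunE ?n_neqS.
case: polyP => _ _ _ _ /(_ Phi h PhiP fh)[p [pth lastp keep]].
(* Strong connectedness confines the path to the section: its flags share with [Phi] every face
   outside indices [n] and [n.+1]. *)
have {}keep g : g \in p -> forall k : 'I_6, k != inord n -> k != inord n.+1 -> g k = Phi k.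
  move=> gp k nk nk1; have /forallP/(_ k)/implyP := allP keep g gp.
  by rewrite hPhi // eqxx => /(_ isT)/eqP.
pose in_orbit f := exists2 t, t \in <[s]> & f = Defs.act t Phi \/ f = Defs.act t Psi.
suff walk f : (forall k, k != inord n -> k != inord n.+1 -> f k = Phi k) ->
    path (adj le rk) f p -> in_orbit f -> in_orbit (last f p).
  rewrite -/(in_orbit h) -lastp; apply: walk => //.
  by exists 1; rewrite ?group1 ?flag_act1; auto.
elim: p keep f {pth lastp} => //= g p IHp keep f keepf /andP[/existsP[j fg] pth] ft.
have keepg : forall k : 'I_6, k != inord n -> k != inord n.+1 -> g k = Phi k.
  by apply: keep; rewrite inE eqxx.
apply: IHp => // [g' g'p|]; first by apply: keep; rewrite inE g'p orbT.
have [_ _ nfg _] := adjP fg.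
have /orP[/eqP Dj | /eqP Dj] : (j == inord n) || (j == inord n.+1).
  apply: contraR nfg; rewrite negb_or => /andP[nj nj1].
  by rewrite keepf // keepg.
(* A step at index [n] exchanges [Psi] with the image of [Phi] under [s], shifting the power of [s]
   by one; a step at [n.+1] exchanges [Phi] and [Psi] under the same power. *)
- have [t ts [Ef | Ef]] := ft.
  + exists (s^-1 * t); first by rewrite groupM ?groupV ?cycle_id.
    right; apply: (adj_unique fg); rewrite Ef Dj flag_actM.
    apply: act_adj; first exact: sub_aut.
    have := act_adj (groupVr auts) adj2; rewrite -flag_actM mulgV flag_act1.
    exact: adj_sym.
  + exists (s * t); first by rewrite groupM ?cycle_id.
    left; apply: (adj_unique fg); rewrite Ef Dj flag_actM.
    by apply: act_adj; first exact: sub_aut.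
- have [t ts [Ef | Ef]] := ft; exists t => //; [right | left];
    apply: (adj_unique fg); rewrite Ef Dj.
    by apply: act_adj; first exact: sub_aut.
  by apply: adj_sym; apply: act_adj; first exact: sub_aut.
Qed.

Lemma cycle_fix t (k : 'I_6) :
  t \in <[s]> -> k != inord n -> k != inord n.+1 -> t (Phi k) = Phi k.
Proof.
case/cycleP=> m -> nk nk1; rewrite permX iter_fix //.
case: genP => _ [Psi [/adjP[_ _ _ eq1] /adjP[_ _ _ eq2]]].
by have := eq2 k nk; rewrite -eq1 // ffunE.
Qed.

(** Chirality enters here: a power of [s] fixing the face at index [n] either fixes all of [Phi] or
    maps it to an adjacent flag, which lies in the other orbit. *)
Lemma cycle_semiregular t : t \in <[s]> -> t (Phi (inord n)) = Phi (inord n) -> t = 1.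
Proof.
move=> ts tn; have autt := sub_aut ts.
have [tn1 | ntn1] := eqVneq (Phi (inord n.+1)) (t (Phi (inord n.+1))).
  apply: (act_free autt PhiP); apply/ffunP=> k; rewrite ffunE.
  have [-> // | nk] := eqVneq k (inord n); have [-> // | nk1] := eqVneq k (inord n.+1).
  exact: cycle_fix.
have adjt : adjn (inord n.+1) Phi (Defs.act t Phi).
  apply: adj_intro; rewrite ?ffunE ?act_flag // => k nk1; rewrite ffunE.
  by have [-> // | nk] := eqVneq k (inord n); rewrite cycle_fix.
by case: (chiralP.2 _ _ _ adjt); exists t => //; apply/autP.
Qed.

(** The powers of [s] act simply transitively on the faces of index [n] in the section. *)
Lemma std_gen_order :
  #[s] = #|[set z | [&& rk z == n, le (Phi (inord n.-1)) z & le z (Phi (inord n.+2))]]|.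
Proof.
have inj_orb : {in <[s]> &, injective (fun t : {perm T} => t (Phi (inord n)))}.
  move=> t1 t2 t1s t2s /= eqt; apply/eqP; rewrite eq_mulgV1; apply/eqP.
  by apply: cycle_semiregular; rewrite ?groupM ?groupV // permM eqt permK.
rewrite orderE -(card_in_imset inj_orb); apply: eq_card => z; rewrite inE.
apply/imsetP/and3P => [[t ts ->] | [/eqP rkz lez gez]].
  have autt := sub_aut ts; have /autP leE := autt; split.
  - have := flag_rk (inord n) (act_flag autt PhiP).
    by rewrite ffunE => ->; rewrite inordK //; lia.
  - rewrite -(cycle_fix ts (k := inord n.-1)) ?leE ?flag_le // -?val_eqE /= ?inordK; lia.
  - rewrite -(cycle_fix ts (k := inord n.+2)) ?leE ?flag_le // -?val_eqE /= ?inordK; lia.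
(* A flag through [z] and the faces of [Phi] outside indices [n] and [n.+1] brings [z] within reach
   of [section_flag]. *)
pose C := z |: [set Phi k | k : 'I_6 in [pred k | (k != inord n) && (k != inord n.+1)]].
have zcmp k : k != inord n -> k != inord n.+1 -> le z (Phi k) || le (Phi k) z.
  rewrite -!val_eqE /= !inordK; try lia; move=> nk nk1.
  have [ltk | lek] := ltnP k n; apply/orP; [right | left].
    by apply: face_trans lez; apply: flag_le; rewrite // inordK; lia.
  by apply: face_trans gez _; apply: flag_le; rewrite // inordK; lia.
have chC : is_chain le C.
  apply/forallP=> x; apply/implyP=> /setU1P[-> | /imsetP[k /andP[nk nk1] ->]];
    apply/forallP=> y; apply/implyP=> /setU1P[-> | /imsetP[l /andP[nl nl1] ->]].
  - by rewrite face_refl.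
  - exact: zcmp.
  - by rewrite orbC zcmp.
  - by case/orP: (leq_total k l) => /(flag_le PhiP) ->; rewrite ?orbT.
have [h fh hC] := flag_of_chain chC.
have hz : h (inord n) = z by rewrite -rkz hC // setU11.
have [|t ts ht] := section_flag fh.
  move=> k nk nk1; have := hC (Phi k); rewrite flag_rk // inord_val; apply.
  by apply/setU1P; right; apply/imsetP; exists k; rewrite // inE nk.
by exists t; rewrite // -ht hz.
Qed.
End Order.

(** The counts in [has_type] are those of [std_gen_order]; for [p] and [r] one bound is the bottom
    or top face and holds trivially. *)
Lemma std_gens_order p q r Phi s1 s2 s3 :
    chiral le rk -> has_type le rk p q r -> isf Phi ->
    std_gen le rk Phi 1 s1 -> std_gen le rk Phi 2 s2 -> std_gen le rk Phi 3 s3 ->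
  [/\ #[s1] = p, #[s2] = q & #[s3] = r].
Proof.
move=> chi [T1 T2 T3] PhiP g1 g2 g3.
have rkPhi m : m < 6 -> rk (Phi (inord m)) = m by move=> ltm; rewrite flag_rk ?inordK.
split.
- rewrite (std_gen_order chi PhiP _ _ g1) // -(T1 (Phi (inord 3))) ?rkPhi //.
  apply: eq_card => z; by rewrite !inE flag_bottom // andbC.
- rewrite (std_gen_order chi PhiP _ _ g2) // -(T2 (Phi (inord 1)) (Phi (inord 4))) ?rkPhi //.
  by apply: flag_le; rewrite ?inordK.
- rewrite (std_gen_order chi PhiP _ _ g3) // -(T3 (Phi (inord 2))) ?rkPhi //.
  apply: eq_card => z; by rewrite !inE flag_top // andbT andbC.
Qed.
End Flags.

(* Application to the two families of types *)
Local Close Scope group_scope.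

Theorem theorem5p12 (beta e1 : nat) (e2 : int) :
  (5 <= beta)%N -> (e1 <= 1)%N -> (e2 = 1 \/ e2 = -1)%R ->
  (forall (T : finType) (le : rel T) (rk : T -> nat) (Phi : {ffun 'I_6 -> T})
          (s1 s2 s3 : {perm T}),
     tight_chiral_std le rk (2 ^ (beta - 1)) (2 ^ beta) 8 Phi s1 s2 s3 ->
     ~ ((s2 * s1^-1 = s1 * gzpow s2 (3 - (e1 * 2 ^ (beta - 1))%N%:Z)%R)%g /\
        (s2 * s3 ^+ 2 = s3 ^+ 2 * gzpow s2 (1 + e2 * (2 ^ (beta - 2))%N%:Z)%R)%g))
  /\
  (forall (T : finType) (le : rel T) (rk : T -> nat) (Phi : {ffun 'I_6 -> T})
          (s1 s2 s3 : {perm T}),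
     tight_chiral_std le rk (2 ^ (beta - 1)) (2 ^ beta) (2 ^ (beta - 1)) Phi s1 s2 s3 ->
     ~ [/\ (s2 * s1^-1 = s1 * gzpow s2 (3 - (e1 * 2 ^ (beta - 1))%N%:Z)%R)%g,
           (s3^-1 * s2 = gzpow s2 (3 + e2 * (2 ^ (beta - 2))%N%:Z)%R
                          * gzpow s3 (1 - (2 ^ (beta - 2))%N%:Z)%R)%g
         & (s3 * s2^-1 = gzpow s2 (-3 + e2 * (2 ^ (beta - 2))%N%:Z)%R
                          * gzpow s3 (-1 + (2 ^ (beta - 2))%N%:Z)%R)%g]).

Proof.
move=> beta5 _ e2P; have beta4 : (4 <= beta)%N by apply: leq_trans beta5.
split=> T le rk Phi s1 s2 s3 [[polyP chiralP] [typeP _] PhiP g1 [g2 g3]].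
- case=> R1 R2; have [s12 s23 s123] := std_gens_relations polyP g1 g2 g3.
  have [_ o2 o3] := std_gens_order polyP chiralP typeP PhiP g1 g2 g3.
  have [wb4 w4 _ nw2] := gzpow_quarter beta4 e2P o2.
  have b2a := conj_sqr_gzpow beta4 e2P o2 s12 R1.
  apply/nw2/(collapse_a s12 s23 s123 _ wb4 w4 b2a); first by rewrite -o3 expg_order.
  by rewrite conjgE R2 mulKg gzpowD.
case=> R1 R2 R3; have [s12 s23 s123] := std_gens_relations polyP g1 g2 g3.
have [_ o2 o3] := std_gens_order polyP chiralP typeP PhiP g1 g2 g3.
have [wb4 w4 _ nw2] := gzpow_quarter beta4 e2P o2.
have b2a := conj_sqr_gzpow beta4 e2P o2 s12 R1.
(* The witness [y] is the involution of the cycle of [s3], whose order is [2 ^ (beta - 1)]. *)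
apply/nw2/(collapse_b (y := (s3 ^+ (2 ^ (beta - 2)))%g) s12 s23 s123 _ wb4 w4 _ _ b2a).
- by rewrite o2 coprimeXl.
- exact: mem_cycle.
- have E : (beta - 2).+1 = (beta - 1)%N by lia.
  by rewrite -expgM -expnSr E -o3 expg_order.
- by rewrite R2 !gzpowD gzpowN.
- by rewrite R3 !gzpowD !gzpowN.
Qed.
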